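(* If $(\mathbb N,U)$ is a universal tournament, then there exists a sequence $X_1,X_2,\dots$ of independent continuous random variables on $[0,1]$ with $E(X_i)=\tfrac12$ for all $i$, such that $P(X_i>X_j)>\tfrac12$ if and only if $i\to j$ in $U$.
   Context: A continuous random variable on $[0,1]$ is one whose distribution function is continuous and strictly increasing on $[0,1]$ with value $0$ at $0$ and $1$ at $1$. A tournament $(T,U)$ ($U\subset T\times T$ with no diagonal pairs and exactly one of $(i,j),(j,i)$ for each distinct $i,j$; $i\to j$ means $(i,j)\in U$) is universal if for every tournament $R$ on a countable set $S$, every finite $S_0\subset S$ and every embedding $\phi:R\cap(S_0\times S_0)\to U$ (an injective map with $i\to j$ iff $\phi(i)\to\phi(j)$), there is an embedding $\psi:R\to U$ extending $\phi$. *)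

(* Defs.v *)
From HB Require Import structures.
From mathcomp Require Import all_boot all_order all_algebra.
From mathcomp Require Import all_classical all_reals all_analysis.
Set Implicit Arguments. Unset Strict Implicit. Unset Printing Implicit Defensive.
Import Order.TTheory GRing.Theory Num.Theory.
Import numFieldTopology.Exports.
Local Open Scope classical_set_scope.
Local Open Scope ring_scope.

Definition is_tournament (S : Type) (U : S -> S -> Prop) : Prop :=
  (forall i, ~ U i i) /\
  (forall i j, i <> j -> (U i j \/ U j i) /\ ~ (U i j /\ U j i)).

Definition tournament_embedding_on (S S' : Type) (D : set S)
    (R : S -> S -> Prop) (U : S' -> S' -> Prop) (phi : S -> S') : Prop :=
  {in D &, injective phi} /\
  (forall i j, D i -> D j -> (R i j <-> U (phi i) (phi j))).

Definition universal_tournament (U : nat -> nat -> Prop) : Prop :=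
  is_tournament U /\
  forall (S : countType) (R : S -> S -> Prop) (S0 : seq S) (phi : S -> nat),
    is_tournament R ->
    tournament_embedding_on [set x | x \in S0] R U phi ->
    exists psi : S -> nat,
      tournament_embedding_on setT R U psi /\
      (forall x, x \in S0 -> psi x = phi x).

Definition mutually_independent d (T : measurableType d) (R : realType)
    (P : probability T R) (X : nat -> {RV P >-> R}) : Prop :=
  forall (J : seq nat) (B : nat -> set R),
    uniq J -> (forall i, i \in J -> measurable (B i)) ->
    P (\bigcap_(i in [set` J]) (X i @^-1` B i)) =
    (\prod_(i <- J) P (X i @^-1` B i))%E.

Definition dist_fun d (T : measurableType d) (R : realType)
    (P : probability T R) (X : {RV P >-> R}) (x : R) : R :=
  fine (cdf X x).

Definition continuous_rv01 d (T : measurableType d) (R : realType)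
    (P : probability T R) (X : {RV P >-> R}) : Prop :=
  let F := dist_fun X in
  continuous F /\
  {in `[0, 1] &, forall x y : R, x < y -> F x < F y} /\
  F 0 = 0 /\ F 1 = 1.

(* Main.v *)
(* Every tournament is realized by perturbations F_i(x) = x + e_i H_i(x) of the
   uniform distribution function.  If H_i(0) = H_i(1) = 0 and the integral of H_i
   over [0,1] vanishes, then E(X_i) = 1/2 and
     P(X_i > X_j) = int F_j dF_i = 1/2 + e_i e_j int H_j H_i',
   where (G, H) |-> int G H' is an alternating form.  Writing w_k = 2 pi (k+1), the
   functions sin(w_k x)/w_k and cos(w_k x) behave like a symplectic basis, so that
     H_i = cos(w_(2i) x) - cos(w_(2i+1) x) + sum_(m < i) +-sin(w_(2m) x)/w_(2m)
   has int H_j H_i' = +-1/2, the sign being free for each pair j < i; it is chosen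
   according to the direction of the edge.

   An independent sequence of uniform variables lives on [0,1] itself: the binary
   digits of a uniform variable split into two independent uniform variables, and
   iterating the splitting on the second one produces the sequence.  Each X_i is
   the quantile function of F_i applied to the i-th uniform variable. *)
Require Import Defs.
From HB Require Import structures.
From mathcomp Require Import all_boot all_order all_algebra.
From mathcomp Require Import all_classical all_reals all_analysis.
From mathcomp Require Import measurable_realfun.
From mathcomp Require Import ring lra zify.
Import Order.TTheory GRing.Theory Num.Theory.
Import numFieldTopology.Exports.
Set Implicit Arguments. Unset Strict Implicit. Unset Printing Implicit Defensive.
Local Open Scope classical_set_scope.
Local Open Scope ring_scope.

(** * Borel measures determined by rays *)

Section Rays.
Context {R : realType}.
Local Notation RR := (measurableTypeR R).

Lemma measurable_generated_by_rays :
  @measurable _ RR = <<s [set A | exists x : R, A = `]-oo, x]%classic] >>.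
Proof.
rewrite eqEsubset; split => A.
  apply: smallest_sub; first exact: smallest_sigma_algebra.
  move=> _ [[a b] _ <-] /=.
  set G := [set A | _].
  have mG x : @measurable _ (g_sigma_algebraType G) `]-oo, x].
    by apply: sub_sigma_algebra; exists x.
  suff -> : `]a, b]%classic = `]-oo, b] `\` `]-oo, a].
    by apply: (@measurableD _ (g_sigma_algebraType G)); exact: mG.
  apply/seteqP; split => x /=; rewrite !in_itv/=.
    by case/andP => ax xb; split => //; apply/negP; rewrite -ltNge.
  by case=> -> /negP; rewrite -ltNge => ->.
apply: smallest_sub; first exact: sigma_algebra_measurable.
by move=> _ [x ->]; exact: measurable_itv.
Qed.

(** Rays are closed under intersection, generate the Borel sets and exhaust the line with finite
    mass, so uniqueness of measures applies. *)
Lemma finite_measure_eq_on_rays (m1 m2 : {measure set RR -> \bar R}) :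
  (forall x : R, m1 `]-oo, x]%classic = m2 `]-oo, x]%classic) ->
  (forall x : R, (m1 `]-oo, x]%classic < +oo)%E) ->
  forall A : set R, @measurable _ RR A -> m1 A = m2 A.
Proof.
move=> m12 m1oo A mA.
apply: (@measure_unique _ R RR [set A | exists x : R, A = `]-oo, x]%classic]
         (fun n => `]-oo, n%:R]%classic)) => //.
- exact: measurable_generated_by_rays.
- move=> _ _ [x ->] [y ->]; exists (Num.min x y).
  by apply/seteqP; split => z /=; rewrite !in_itv/= le_min => /andP.
- by move=> n; exists n%:R.
- apply/seteqP; split => // x _; exists (Num.truncn x).+1 => //=.
  by rewrite in_itv/= ltW// truncnS_gt.
- by move=> _ [x ->].
Qed.

(** With the second ray fixed, both sides are finite measures in the first set: the image under [f]
    of a restriction of [P], and a multiple of the image of [P]. They agree on rays, hence on Borel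
    sets; the same argument then frees the second set. *)
Lemma independent_of_rays d (T : measurableType d) (P : probability T R)
    (f g : {mfun T >-> RR}) :
  (forall s t : R, P (f @^-1` `]-oo, s] `&` g @^-1` `]-oo, t]) =
     (P (f @^-1` `]-oo, s]) * P (g @^-1` `]-oo, t]))%E) ->
  forall A B : set R, measurable A -> measurable B ->
    P (f @^-1` A `&` g @^-1` B) = (P (f @^-1` A) * P (g @^-1` B))%E.
Proof.
move=> fg A B mA mB.
have mf C : measurable C -> measurable (f @^-1` C) by exact: measurable_funPTI.
have mg C : measurable C -> measurable (g @^-1` C) by exact: measurable_funPTI.
have Pfin C : measurable C -> P C \is a fin_num by move=> ?; exact: fin_num_measure.
have Ploo C : measurable C -> (P C < +oo)%E.
  by move=> mC; rewrite ltey_eq Pfin.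
have step1 t C : measurable C ->
    P (f @^-1` C `&` g @^-1` `]-oo, t]) = (P (f @^-1` C) * P (g @^-1` `]-oo, t]))%E.
  move=> mC.
  have mt := mg _ (measurable_itv `]-oo, t]).
  have P0 : 0 <= fine (P (g @^-1` `]-oo, t])) by rewrite fine_ge0.
  have e X : mscale (NngNum P0) (pushforward P f) X =
      (P (f @^-1` X) * P (g @^-1` `]-oo, t]))%E.
    by rewrite /mscale /pushforward/= fineK ?Pfin// muleC.
  rewrite -e; apply: (@finite_measure_eq_on_rays
    (pushforward (mrestr P mt) f) (mscale (NngNum P0) (pushforward P f))) => // s.
    exact: etrans (fg _ _) (esym (e _ _)).
  by apply: Ploo; apply: measurableI => //; apply: mf.
have mfA := mf _ mA.
have P0 : 0 <= fine (P (f @^-1` A)) by rewrite fine_ge0.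
have e X : mscale (NngNum P0) (pushforward P g) X =
    (P (f @^-1` A) * P (g @^-1` X))%E.
  by rewrite /mscale /pushforward/= fineK ?Pfin.
rewrite -e setIC; apply: (@finite_measure_eq_on_rays
  (pushforward (mrestr P mfA) g) (mscale (NngNum P0) (pushforward P g))) => // s.
  by apply: etrans (esym (e _ _)); rewrite -step1// setIC.
by apply: Ploo; apply: measurableI => //; apply: mg.
Qed.

End Rays.

(** * Splitting a uniform variable into two *)

Section Digits.
Local Open Scope nat_scope.

(* Base-4 digits of [c], each mapped to a binary digit by [b]. *)
Fixpoint digits (b : nat -> nat) (n c : nat) : nat :=
  if n is m.+1 then ((digits b m (c %/ 4)).*2 + b (c %% 4))%N else 0.

(** A base-4 digit is 2h + l with binary digits h and l; [hi_bit] reads off h and [lo_bit] reads off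
    l. *)
Definition hi_bit (r : nat) : nat := (1 < r)%N.
Definition lo_bit (r : nat) : nat := odd r.

Lemma sum_4mul (f : nat -> nat) m :
  (\sum_(c < 4 * m) f c =
   \sum_(c < m) (f (4 * c) + f (4 * c + 1) + f (4 * c + 2) + f (4 * c + 3)))%N.
Proof.
elim: m => [|m IH]; first by rewrite muln0 !big_ord0.
rewrite (_ : (4 * m.+1)%N = (4 * m).+4); last by lia.
by rewrite 5!big_ord_recr/= IH addn1 addn2 addn3 !addnA.
Qed.

Lemma sum_2mul (f : nat -> nat) m :
  (\sum_(c < 2 * m) f c = \sum_(c < m) (f c.*2 + f (c.*2.+1)))%N.
Proof.
elim: m => [|m IH]; first by rewrite muln0 !big_ord0.
rewrite (_ : (2 * m.+1)%N = (2 * m).+2); last by lia.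
by rewrite 3!big_ord_recr/= IH mul2n !addnA.
Qed.

(** The two digit maps together give a bijection from the numbers below 4^n onto the pairs of
    numbers below 2^n, expressed here through sums. The induction peels off the last base-4
    digit. *)
Lemma sum_digits (f : nat -> nat -> nat) n :
  (\sum_(c < 4 ^ n) f (digits hi_bit n c) (digits lo_bit n c) =
   \sum_(i < 2 ^ n) \sum_(j < 2 ^ n) f i j)%N.
Proof.
elim: n f => [|n IH] f; first by rewrite !big_ord1.
(* [g] gathers the four ways to append one binary digit to i and one to j. *)
pose g i j := (f i.*2 j.*2 + f i.*2 j.*2.+1 + f i.*2.+1 j.*2 + f i.*2.+1 j.*2.+1)%N.
transitivity (\sum_(c < 4 ^ n) g (digits hi_bit n c) (digits lo_bit n c))%N.
  rewrite expnS.
  apply: etrans (sum_4mul (fun c => f (digits hi_bit n.+1 c) (digits lo_bit n.+1 c)) _) _.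
  apply: eq_bigr => c _ /=.
  have q r : (r < 4)%N -> ((4 * c + r) %/ 4 = c)%N /\ ((4 * c + r) %% 4 = r)%N.
    by move=> ?; lia.
  have [] := q 0%N isT; rewrite addn0 => -> ->; have [-> ->] := q 1%N isT.
  have [-> ->] := q 2%N isT; have [-> ->] := q 3%N isT.
  by rewrite /hi_bit /lo_bit /= !addn0 !addn1.
rewrite IH expnS; apply/esym.
apply: etrans (sum_2mul (fun i => \sum_(j < _) f i j)%N _) _.
apply: eq_bigr => i _; rewrite (sum_2mul (f i.*2)) (sum_2mul (f i.*2.+1)) -big_split/=.
by apply: eq_bigr => j _; rewrite /g; lia.
Qed.

Lemma sum_ltn a m : (\sum_(i < m) (i < a) = minn a m)%N.
Proof. by elim: m => [|m IH]; rewrite ?big_ord0 ?big_ord_recr/= ?IH; lia. Qed.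

(** The indicator of a quadrant is a product, so the double sum factors: this is the discrete form
    of the independence of the two halves. *)
Lemma count_digits n a b :
  (\sum_(c < 4 ^ n) ((digits hi_bit n c < a) && (digits lo_bit n c < b)) =
   minn a (2 ^ n) * minn b (2 ^ n))%N.
Proof.
rewrite (sum_digits (fun i j => (i < a)%N && (j < b)%N : nat)) -!sum_ltn big_distrl/=.
apply: eq_bigr => i _; rewrite big_distrr/=; apply: eq_bigr => j _.
by rewrite mulnb.
Qed.

End Digits.

(** * Binary expansions read off from 4-adic cells *)

Section Cells.
Context {R : realType}.

Definition cell (n : nat) (x : R) : nat := Num.truncn (4 ^+ n * x).

Lemma cell_div n x : (cell n.+1 x %/ 4)%N = cell n x.
Proof.
(* [truncn] sends negative numbers to 0, so both sides vanish for negative x. *)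
have [x0|x0] := leP 0 x; last first.
  have neg m : cell m x = 0%N.
    apply/truncn0Pn; rewrite -ltNge (lt_le_trans _ ler01)//.
    by rewrite pmulr_rlt0 ?exprn_gt0.
  by rewrite !neg.
have p0 m : 0 <= 4 ^+ m * x by rewrite mulr_ge0// exprn_ge0.
have := truncn_itv (p0 n.+1); rewrite -/(cell _ _); set k := cell _ _ => /andP[k1 k2].
apply/esym/truncn_def; rewrite exprS -mulrA in k1 k2.
set y := 4 ^+ n * x in k1 k2 *.
have e : k = (k %/ 4 * 4 + k %% 4)%N by exact: divn_eq.
have m4 : (k %% 4 < 4)%N by exact: ltn_mod.
apply/andP; split.
  have : ((k %/ 4 * 4)%:R : R) <= k%:R by rewrite ler_nat leq_divM.
  rewrite natrM; lra.
have : (k.+1%:R : R) <= ((k %/ 4).+1 * 4)%:R by rewrite ler_nat; lia.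
by rewrite natrM; lra.
Qed.

Definition dyadic (b : nat -> nat) (n : nat) (x : R) : R :=
  (digits b n (cell n x))%:R / 2 ^+ n.

(** The real number whose binary digits are those selected by [b]. Its truncations increase, so a
    supremum can stand for the sum of the series. *)
Definition split_digits (b : nat -> nat) (x : R) : R := sup (range (dyadic b ^~ x)).

Variable b : nat -> nat.
Hypothesis b1 : forall r, (b r <= 1)%N.

(** The increment is a binary digit times 2^-(n+1). Its upper bound is written as a difference so
    that it telescopes in [dyadic_mono]. *)
Lemma dyadic_step n x :
  dyadic b n x <= dyadic b n.+1 x <= dyadic b n x + 2 ^- n - 2 ^- n.+1.
Proof.
rewrite /dyadic /= cell_div; have := b1 (cell n.+1 x %% 4)%N.
set r := b _; set d := digits _ _ _ => r1.
have r0 : 0 <= (r%:R : R) <= 1 by rewrite ler0n -(ler_nat R) in r1 *.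
have p0 : 0 < (2 ^- n.+1 : R) by rewrite invr_gt0 exprn_gt0.
have e : (2 ^- n : R) = 2 * 2 ^- n.+1.
  by rewrite exprS invfM mulrA divff ?mul1r.
rewrite natrD -muln2 natrM e; set y := 2 ^- n.+1 in p0 *.
by apply/andP; split; nra.
Qed.

Lemma dyadic_mono m n x : (m <= n)%N ->
  dyadic b m x <= dyadic b n x <= dyadic b m x + 2 ^- m - 2 ^- n.
Proof.
elim: n => [|n IH]; first by rewrite leqn0 => /eqP ->; lra.
rewrite leq_eqVlt => /predU1P[->|]; first by lra.
rewrite ltnS => /IH; have := dyadic_step n x; lra.
Qed.

Lemma split_digits_bounds n x :
  dyadic b n x <= split_digits b x <= dyadic b n x + 2 ^- n.
Proof.
have p0 m : 0 < (2 ^- m : R) by rewrite invr_gt0 exprn_gt0.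
have ub : ubound (range (dyadic b ^~ x)) (dyadic b n x + 2 ^- n).
  move=> _ [m _ <-]; have [mn|/ltnW mn] := leqP m n.
    by have := dyadic_mono x mn; have := p0 n; lra.
  by have := dyadic_mono x mn; have := p0 m; lra.
apply/andP; split; last by apply: ge_sup => //; exists (dyadic b 0 x), 0%N.
by apply: ub_le_sup; [exists (dyadic b n x + 2 ^- n)|exists n].
Qed.

Lemma split_digits_ge0_le1 x : 0 <= split_digits b x <= 1.
Proof. by have := split_digits_bounds 0 x; rewrite /dyadic/= mul0r expr0 invr1; lra. Qed.

(** This turns an event about the limit into a countable intersection of events about cells, which
    gives measurability. *)
Lemma split_digits_le (s x : R) :
  (split_digits b x <= s) <-> (forall n, dyadic b n x <= s).
Proof.
split=> [h n|h]; first by have := split_digits_bounds n x; lra.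
by apply: ge_sup => [|_ [m _ <-]]; [exists (dyadic b 0 x), 0%N|].
Qed.

Lemma measurable_cell n (S : set nat) :
  measurable [set x : measurableTypeR R | S (cell n x)].
Proof.
have mcell : measurable_fun [set: measurableTypeR R] (fun x => (cell n x)%:R : R).
  apply: nondecreasing_measurable => // x y xy.
  by rewrite ler_nat le_truncn// ler_wpM2l// exprn_ge0.
rewrite (_ : [set x | _] = \bigcup_(k in S) ((fun x => (cell n x)%:R : R) @^-1` [set k%:R])).
  apply: bigcup_measurable => k _.
  by rewrite -[X in measurable X]setTI; exact: mcell.
apply/seteqP; split => x /=.
  by move=> Sx; exists (cell n x).
by move=> [k Sk] /= /eqP; rewrite eqr_nat => /eqP ->.
Qed.

Lemma measurable_dyadic n : measurable_fun [set: measurableTypeR R] (dyadic b n).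
Proof.
move=> _ Y mY; rewrite setTI.
exact: (measurable_cell n [set k | Y ((digits b n k)%:R / 2 ^+ n)]).
Qed.

Lemma measurable_split_digits :
  measurable_fun [set: measurableTypeR R] (split_digits b : _ -> measurableTypeR R).
Proof.
apply: (measurability _ measurable_generated_by_rays) => _ [_ [s ->] <-].
rewrite setTI (_ : _ @^-1` _ = \bigcap_n [set x | dyadic b n x <= s]).
  apply: bigcapT_measurable => n.
  rewrite (_ : [set x | _] = [set: measurableTypeR R] `&` dyadic b n @^-1` `]-oo, s]).
    exact: measurable_dyadic.
  by apply/seteqP; split => x /=; rewrite in_itv/= => // -[].
apply/seteqP; split => x /=; rewrite in_itv/=.
  by move/split_digits_le => h n _; exact: h.
by move=> h; apply/split_digits_le => n; exact: h.
Qed.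

End Cells.

(** * Uniformity and independence of the two halves *)

Section Splitting.
Context {R : realType}.
Local Notation RR := (measurableTypeR R).
Local Notation unif := (uniform_prob (@ltr01 R)).

Lemma unif_itv (a b : R) (x y : bool) : 0 <= a -> a <= b -> b <= 1 ->
  unif [set` Interval (BSide x a) (BSide y b)] = (b - a)%:E.
Proof.
move=> a0 ab b1; have zab z : [set` Interval (BSide x a) (BSide y b)] z -> `[0, 1]%classic z.
  by case: x y => -[] /=; rewrite !in_itv/=; lra.
rewrite /uniform_prob integral_uniform_pdf setIidl//.
rewrite (eq_integral (fun=> 1%:E)) => [|z]; last first.
  by rewrite inE => /zab; rewrite /= in_itv/= /uniform_pdf subr0 invr1 => ->.
rewrite integral_cst//= mul1e lebesgue_measure_itv/= lte_fin.
by case: ltP => // ba; rewrite (le_anti (introT andP (conj ab ba))) subrr.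
Qed.

Lemma unif_ray (s : R) : 0 <= s <= 1 -> unif `]-oo, s] = s%:E.
Proof.
case/andP => s0 s1; rewrite /uniform_prob integral_uniform_pdf.
rewrite (_ : _ `&` _ = `[0, s]%classic `&` `[0, 1]).
  by rewrite -integral_uniform_pdf -/(unif _) unif_itv// subr0.
by apply/seteqP; split => x /=; rewrite !in_itv/=; lra.
Qed.

(** Each cell has mass 4^-n. Restricting to [0,1) keeps out the negative points, which all have cell
    0, and the points from 1 on, whose cell is at least 4^n. *)
Lemma unif_cells (n : nat) (S : pred nat) :
  unif [set x | 0 <= x < 1 /\ S (cell n x)] =
  ((\sum_(k < 4 ^ n) S k)%N%:R / 4 ^+ n)%:E.
Proof.
have p0 : 0 < 4 ^+ n :> R by exact: exprn_gt0.
pose I (k : 'I_(4 ^ n)) : set RR := `[k%:R / 4 ^+ n, k.+1%:R / 4 ^+ n[%classic.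
have IP k x : I k x <-> 0 <= x < 1 /\ cell n x = k.
  rewrite /I/= in_itv/= ler_pdivrMr// ltr_pdivlMr// mulrC /cell; split.
    move=> h; have /= e := truncn_def h; split=> //.
    move/andP: h => [h1 h2]; rewrite -(pmulr_rge0 _ p0) -(ltr_pM2l p0) mulr1.
    rewrite (le_trans _ h1)// (lt_le_trans h2)//.
    by rewrite -natrX ler_nat ltn_ord.
  move=> [/andP[x0 x1] <-]; apply: truncn_itv.
  by rewrite mulr_ge0// ltW.
rewrite (_ : [set x | _] = \big[setU/set0]_(k < 4 ^ n | S k) I k); last first.
  rewrite -bigcup_seq_cond; apply/seteqP; split => x.
    move=> [x01 Sx]/=.
    have lt : (cell n x < 4 ^ n)%N.
      case/andP: (x01) => x0 x1.
      by rewrite truncn_lt_nat ?natrX ?gtr_pMr//; apply: mulr_ge0 => //; exact: ltW.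
    by exists (Ordinal lt) => /=; [rewrite mem_index_enum|apply/IP].
  by move=> [k /= /andP[_ Sk] /IP[x01 e]]; split => //; rewrite e.
rewrite measure_bigsetU_ord//; last first.
  apply/trivIsetP => i j _ _ ij; rewrite -subset0 => x [/IP[_ ei] /IP[_ ej]].
  by move/eqP: ij; apply; apply/val_inj; rewrite /= -ei -ej.
  by move=> k; exact: measurable_itv.
rewrite (eq_bigr (fun=> (4 ^- n)%:E)) => [|k _]; last first.
  change (unif (I k) = (4 ^- n)%:E); rewrite /I unif_itv ?divr_ge0// ?ler_pM2r ?invr_gt0 ?ler_nat//.
    by rewrite -mulrBl -natrB// subSnn mul1r.
  by rewrite ler_pdivrMr// mul1r -natrX ler_nat ltn_ord.
rewrite sumEFin; congr _%:E; rewrite big_mkcond/= natr_sum mulr_suml.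
by apply: eq_bigr => k _; case: (S k); rewrite ?mul1r ?mul0r.
Qed.

(** The complement of [0,1) is a null set, so the inclusion only has to be checked inside. *)
Lemma unif_le01 (A B : set RR) : measurable A -> measurable B ->
  (forall x, 0 <= x < 1 -> A x -> B x) -> (unif A <= unif B)%E.
Proof.
move=> mA mB AB; pose C : set RR := `[0, 1[%classic.
have mC : measurable C by exact: measurable_itv.
have C0 : unif (~` C) = 0%E.
  rewrite probability_setC//.
  by transitivity (1 - unif C)%E => //; rewrite /C unif_itv// subr0 subee.
apply: (@le_trans _ _ (unif (B `|` ~` C))).
  apply: le_measure; rewrite ?inE//; first by apply: measurableU => //; exact: measurableC.
  move=> x Ax; have [Cx|nCx] := pselect (C x); last by right.
  by left; apply: AB => //; move: Cx; rewrite /C /= in_itv.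
apply: (@le_trans _ _ (unif B + unif (~` C))%E); last by rewrite C0 adde0.
by apply: measureU2 => //; exact: measurableC.
Qed.

Definition hi : RR -> RR := split_digits hi_bit.
Definition lo : RR -> RR := split_digits lo_bit.

Lemma hi_bit_le1 r : (hi_bit r <= 1)%N. Proof. by rewrite /hi_bit; case: (_ < _)%N. Qed.
Lemma lo_bit_le1 r : (lo_bit r <= 1)%N. Proof. by rewrite /lo_bit; case: odd. Qed.

Lemma hi_ge0_le1 x : 0 <= hi x <= 1. Proof. exact: split_digits_ge0_le1 hi_bit_le1 x. Qed.
Lemma lo_ge0_le1 x : 0 <= lo x <= 1. Proof. exact: split_digits_ge0_le1 lo_bit_le1 x. Qed.

Lemma dyadic_le_natP b n x (s : R) : 0 <= s ->
  (dyadic b n x <= s) = (digits b n (cell n x) < (Num.truncn (2 ^+ n * s)).+1)%N.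
Proof.
move=> s0; rewrite ltnS truncn_ge_nat ?mulr_ge0 ?exprn_ge0//.
by rewrite /dyadic ler_pdivrMr ?exprn_gt0// mulrC.
Qed.

Lemma measurable_hi_lo (s t : R) :
  measurable (hi @^-1` `]-oo, s] `&` lo @^-1` `]-oo, t]).
Proof.
have mh := @measurable_split_digits R _ hi_bit_le1.
have ml := @measurable_split_digits R _ lo_bit_le1.
by apply: measurableI; rewrite -[X in measurable X]setTI; [exact: mh|exact: ml].
Qed.

Lemma measurable_cells n (S : pred nat) :
  measurable ([set x | 0 <= x < 1 /\ S (cell n x)] : set RR).
Proof.
rewrite (_ : [set x | _] = `[0, 1[%classic `&` [set x | S (cell n x)]).
  by apply: measurableI; [exact: measurable_itv|exact: (measurable_cell n S)].
by apply/seteqP; split => x /=; rewrite in_itv.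
Qed.

(** The event lies between two unions of cells: it contains the cells with digits below (a, b) and,
    within [0,1), is covered by those with digits below (a+1, b+1). [count_digits] gives the mass of
    both. *)
Lemma unif_hi_lo_near (s t : R) n : 0 <= s <= 1 -> 0 <= t <= 1 ->
  `|fine (unif (hi @^-1` `]-oo, s] `&` lo @^-1` `]-oo, t])) - s * t| <= 3 * 2 ^- n.
Proof.
move=> /andP[s0 s1] /andP[t0 t1].
set A := _ `&` _; have mA : measurable A := measurable_hi_lo s t.
pose a := Num.truncn (2 ^+ n * s); pose b := Num.truncn (2 ^+ n * t).
pose S a b : pred nat := fun c => (digits hi_bit n c < a)%N && (digits lo_bit n c < b)%N.
have PS a' b' : unif [set x | 0 <= x < 1 /\ S a' b' (cell n x)] =
    ((minn a' (2 ^ n) * minn b' (2 ^ n))%N%:R / 4 ^+ n)%:E.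
  by rewrite unif_cells count_digits.
have e4 : 4 ^+ n = 2 ^+ n * 2 ^+ n :> R by rewrite -exprMn -natrM.
have p0 : 0 < 2 ^+ n :> R by rewrite exprn_gt0.
have hb x : dyadic hi_bit n x <= hi x <= dyadic hi_bit n x + 2 ^- n.
  exact: split_digits_bounds hi_bit_le1 n x.
have lb x : dyadic lo_bit n x <= lo x <= dyadic lo_bit n x + 2 ^- n.
  exact: split_digits_bounds lo_bit_le1 n x.
have AE x : A x <-> hi x <= s /\ lo x <= t by rewrite /A/= !in_itv/=.
have up : (unif A <= unif [set x | (0 <= x < 1)%R /\ S a.+1 b.+1 (cell n x)])%E.
  apply: unif_le01 => //; first exact: measurable_cells.
  move=> x x01 /AE[hs lt]; split => //; rewrite /S -!dyadic_le_natP//.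
  by apply/andP; split; [have := hb x|have := lb x]; lra.
have dn : (unif [set x | (0 <= x < 1)%R /\ S a b (cell n x)] <= unif A)%E.
  apply: unif_le01 => //; first exact: measurable_cells.
  move=> x _ [_ /andP[/= ha lb']]; apply/AE.
  (* A strict inequality between integers leaves room for one unit 2^-n, which covers the digits cut
     off. *)
  have key bb (r : R) c : 0 <= r -> (digits bb n (cell n x) < c)%N -> c = Num.truncn (2 ^+ n * r) ->
      dyadic bb n x + 2 ^- n <= r.
    move=> r0 dc ce; rewrite /dyadic -[X in _ + X]mul1r -mulrDl ler_pdivrMr// (mulrC r).
    rewrite (@le_trans _ _ (Num.truncn (2 ^+ n * r))%:R)//.
      by rewrite -ce natr1 ler_nat.
    by rewrite truncn_le mulr_ge0// ltW.
  have := key _ _ _ s0 ha erefl; have := key _ _ _ t0 lb' erefl.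
  by split; [have := hb x|have := lb x]; lra.
have fA : unif A \is a fin_num by exact: fin_num_measure.
rewrite PS in up; rewrite PS in dn.
rewrite -(fineK fA) lee_fin in up; rewrite -(fineK fA) lee_fin in dn.
set p := fine _ in up dn *.
have ha := truncn_itv (mulr_ge0 (ltW p0) s0); have hb' := truncn_itv (mulr_ge0 (ltW p0) t0).
rewrite -/a -/b in ha hb'.
have pow (r : R) c : c = Num.truncn (2 ^+ n * r) -> 0 <= r -> r <= 1 -> (c <= 2 ^ n)%N.
  move=> -> r0 r1; rewrite -(ler_nat R) natrX.
  apply: (@le_trans _ _ (2 ^+ n * r)); last by rewrite ger_pMr.
  by rewrite truncn_le mulr_ge0// ltW.
rewrite (minn_idPl (pow s a erefl s0 s1)) (minn_idPl (pow t b erefl t0 t1)) in dn.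
(* For s = 1 the number a+1 exceeds 2^n, so here the minima are only bounded from above. *)
have {}up : p <= (a.+1 * b.+1)%N%:R / 4 ^+ n.
  apply: le_trans up _; rewrite ler_pM2r ?invr_gt0 ?exprn_gt0// ler_nat.
  by rewrite leq_mul// geq_minl.
rewrite e4 natrM invfM mulrACA in dn; rewrite e4 natrM invfM mulrACA in up.
have b1 (r : R) c : (c%:R <= 2 ^+ n * r < c.+1%:R) ->
  r - 2 ^- n <= c%:R / 2 ^+ n <= r /\ c.+1%:R / 2 ^+ n = c%:R / 2 ^+ n + 2 ^- n :> R.
  move=> /andP[c1 c2].
  have e : c.+1%:R / 2 ^+ n = c%:R / 2 ^+ n + 2 ^- n :> R.
    by rewrite -(natr1 c) mulrDl mul1r.
  split => //; rewrite lerBlDr -e ler_pdivlMr// ler_pdivrMr// (mulrC r).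
  by rewrite ltW.
have [] := b1 _ _ ha; have [] := b1 _ _ hb'.
set x := a%:R / _ in dn *; set y := b%:R / _ in dn *.
move=> hy ey hx ex; rewrite ex ey in up.
have x0 : 0 <= x by rewrite divr_ge0// ltW.
have y0 : 0 <= y by rewrite divr_ge0// ltW.
have d0 : 0 < (2 ^- n : R) by rewrite invr_gt0.
have d1 : (2 ^- n : R) <= 1 by rewrite invf_le1// exprn_ege1// ler1n.
set e := 2 ^- n in hx hy up d0 d1 *.
(* The upper error is at most e(s + t) + e^2 and the lower one at most e(s + t); both are at most 3e
   because s, t and e are at most 1. *)
rewrite ler_norml; apply/andP; split; nra.
Qed.

(** A nonzero defect would exceed the error 3 / 2^n of [unif_hi_lo_near] for large n. *)
Lemma unif_hi_lo (s t : R) : 0 <= s <= 1 -> 0 <= t <= 1 ->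
  unif (hi @^-1` `]-oo, s] `&` lo @^-1` `]-oo, t]) = (s * t)%:E.
Proof.
move=> s01 t01; have mA := measurable_hi_lo s t.
rewrite -[LHS]fineK ?fin_num_measure//; congr _%:E; apply/eqP.
rewrite -subr_eq0 -normr_le0 leNgt; apply/negP => z0.
have := unif_hi_lo_near (Num.truncn (3 / `|fine (unif
  (hi @^-1` `]-oo, s] `&` lo @^-1` `]-oo, t])) - s * t|)).+1 s01 t01.
set z := `|_| in z0 *; set n := _.+1; apply/negP; rewrite -ltNge.
rewrite ltr_pdivrMr ?exprn_gt0// mulrC -ltr_pdivrMr//.
rewrite (lt_le_trans (truncnS_gt _))// -natrX ler_nat ltnW//; exact: ltn_expl.
Qed.

(** Since [hi] and [lo] take values in [0,1], a negative endpoint gives an empty event and an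
    endpoint above 1 can be replaced by 1. *)
Lemma unif_hi_lo_rays (s t : R) :
  unif (hi @^-1` `]-oo, s] `&` lo @^-1` `]-oo, t]) =
  (unif `]-oo, s] * unif `]-oo, t])%E.
Proof.
have hb := hi_ge0_le1; have lb := lo_ge0_le1.
have neg (r : R) : r < 0 -> unif `]-oo, r] = 0%E.
  move=> r0; apply/eqP; rewrite eq_le measure_ge0 andbT.
  apply: (@le_trans _ _ (unif `]-oo, 0])); last by rewrite unif_ray// lexx ler01.
  by apply: le_measure; rewrite ?inE//; apply: subset_itvl; rewrite bnd_simp ltW.
have [s0|s0] := ltP s 0.
  rewrite neg// mul0e (_ : _ `&` _ = set0) ?measure0// -subset0 => x [/=].
  by rewrite in_itv/=; have := hb x; lra.
have [t0|t0] := ltP t 0.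
  rewrite (neg t)// mule0 (_ : _ `&` _ = set0) ?measure0// -subset0 => x [_ /=].
  by rewrite in_itv/=; have := lb x; lra.
have big (r : R) : 0 <= r -> unif `]-oo, r] = (Num.min r 1)%:E.
  move=> r0; have [r1|r1] := leP r 1; first by rewrite unif_ray// r0.
  apply/eqP; rewrite eq_le probability_le1//= -[leLHS](@unif_ray 1) ?ler01 ?lexx//.
  by apply: le_measure; rewrite ?inE//; apply: subset_itvl; rewrite bnd_simp ltW.
rewrite !big// -EFinM -unif_hi_lo ?le_min ?s0 ?t0 ?ler01 ?ge_min ?lexx ?orbT//.
congr (unif _); apply/seteqP; split => x /=; rewrite !in_itv/= !le_min.
  by have := hb x; have := lb x; move=> /andP[_ ->] /andP[_ ->] [-> ->].
by move=> [/andP[-> _] /andP[-> _]].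
Qed.

HB.instance Definition _ := @isMeasurableFun.Build _ _ RR RR hi
  (@measurable_split_digits R _ hi_bit_le1).
HB.instance Definition _ := @isMeasurableFun.Build _ _ RR RR lo
  (@measurable_split_digits R _ lo_bit_le1).

(** The marginal law on rays comes from the joint law by adding the condition that [lo] is at most
    1, which always holds. *)
Lemma unif_hi (A : set RR) : measurable A -> unif (hi @^-1` A) = unif A.
Proof.
move=> mA; apply: (@finite_measure_eq_on_rays R (pushforward unif hi) unif) => // s.
  transitivity (unif (hi @^-1` `]-oo, s] `&` lo @^-1` `]-oo, 1])).
    congr (unif _); apply/seteqP; split => x //=; last by case.
    rewrite !in_itv/=; split => //.
    by have /andP[] := lo_ge0_le1 x.
  rewrite unif_hi_lo_rays (@unif_ray 1) ?ler01 ?lexx// mule1//.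
apply: (@le_lt_trans _ _ 1%E); last exact: ltry.
apply: probability_le1; exact: measurable_funPTI.
Qed.

Lemma unif_lo (A : set RR) : measurable A -> unif (lo @^-1` A) = unif A.
Proof.
move=> mA; apply: (@finite_measure_eq_on_rays R (pushforward unif lo) unif) => // t.
  transitivity (unif (hi @^-1` `]-oo, 1] `&` lo @^-1` `]-oo, t])).
    congr (unif _); apply/seteqP; split => x //=; last by case.
    rewrite !in_itv/=; split => //.
    by have /andP[] := hi_ge0_le1 x.
  rewrite unif_hi_lo_rays (@unif_ray 1) ?ler01 ?lexx// mul1e//.
apply: (@le_lt_trans _ _ 1%E); last exact: ltry.
apply: probability_le1; exact: measurable_funPTI.
Qed.

Lemma unif_hi_lo_indep (A B : set RR) : measurable A -> measurable B ->
  unif (hi @^-1` A `&` lo @^-1` B) = (unif A * unif B)%E.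
Proof.
move=> mA mB; rewrite -(unif_hi mA) -(unif_lo mB).
apply: (@independent_of_rays R _ RR unif hi lo) => // s t.
apply: etrans (unif_hi_lo_rays s t) _.
by congr (_ * _)%E; [rewrite -unif_hi|rewrite -unif_lo].
Qed.

(** * An independent sequence of uniform variables on [0,1] *)

Definition iid (n : nat) : RR -> RR := hi \o iter n lo.

Lemma measurable_iid n : measurable_fun [set: RR] (iid n).
Proof.
apply: measurableT_comp; first exact: measurable_funPT.
elim: n => [|n IH] /=; first exact: measurable_id.
by apply: measurableT_comp => //; exact: measurable_funPT.
Qed.

HB.instance Definition _ n := @isMeasurableFun.Build _ _ RR RR (iid n)
  (@measurable_iid n).

Lemma iid_shift n : iid n.+1 = iid n \o lo.
Proof. by apply/funext => x; rewrite /iid/= -iterSr. Qed.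

Lemma unif_iid n (A : set RR) : measurable A -> unif (iid n @^-1` A) = unif A.
Proof.
elim: n A => [|n IH] A mA; first exact: unif_hi.
rewrite iid_shift comp_preimage unif_lo ?IH//.
by rewrite -[X in measurable X]setTI; exact: measurable_iid.
Qed.

Lemma iid_ge0_le1 n x : 0 <= iid n x <= 1.
Proof. exact: hi_ge0_le1. Qed.

(** By [iid_shift] the variables after the first are the same sequence evaluated at [lo], while the
    first is [hi]. Independence of [hi] and [lo] splits off one factor, and the induction hypothesis
    applies to the shifted sets. *)
Lemma iid_independent N (B : nat -> set RR) : (forall n, measurable (B n)) ->
  unif (\bigcap_(n in `I_N) (iid n @^-1` B n)) = (\prod_(0 <= n < N) unif (B n))%E.
Proof.
elim: N B => [|N IH] B mB.
  by rewrite II0 bigcap_set0 big_geq// probability_setT.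
have mC : measurable (\bigcap_(n in `I_N) (iid n @^-1` B n.+1)).
  apply: bigcap_measurableType => n _.
  by rewrite -[X in measurable X]setTI; exact: measurable_iid.
rewrite big_nat_recl// -(IH (fun n => B n.+1))// -unif_hi_lo_indep//.
congr (unif _); apply/seteqP; split => x /=.
  move=> h; split; first exact: (h 0%N).
  by move=> n nN; have := h n.+1 nN; rewrite iid_shift.
move=> [h0 h] [|n] nN; first exact: h0.
by have := h n nN; rewrite iid_shift.
Qed.

End Splitting.

(** * Comparing two independent variables through their distribution functions *)

Section Primitives.
Context {R : realType}.
Implicit Types f k : R -> R.

(** In the comparison and the trigonometric computations below, integrals are increments of such
    antiderivatives, taken on the whole line. *)
Definition primitive (K k : R -> R) := forall x : R, is_derive x (1 : R) K (k x).

Lemma primitive_continuous K k : primitive K k -> continuous K.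
Proof.
move=> dK x; apply: differentiable_continuous; apply/derivable1_diffP.
by have [] := dK x.
Qed.

Lemma primitive_ge0_le K k (x y : R) : primitive K k -> x <= y ->
  (forall z, x <= z <= y -> 0 <= k z) -> K x <= K y.
Proof.
move=> dK; rewrite le_eqVlt => /predU1P[-> //|xy] k0.
have [|z zxy e] := @MVT R K k x y xy (fun z _ => dK z).
  exact/continuous_subspaceT/(primitive_continuous dK).
rewrite -subr_ge0 e mulr_ge0 ?subr_ge0 ?(ltW xy)//.
by apply: k0; move: zxy; rewrite in_itv/= => /andP[/ltW -> /ltW ->].
Qed.

Lemma primitiveD K k L l : primitive K k -> primitive L l ->
  primitive (fun x => K x + L x) (fun x => k x + l x).
Proof. by move=> dK dL x; exact: is_deriveD. Qed.

Lemma primitiveZ (a : R) K k : primitive K k ->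
  primitive (fun x => a * K x) (fun x => a * k x).
Proof. by move=> dK x; exact: is_deriveZ. Qed.

Lemma primitiveM K k L l : primitive K k -> primitive L l ->
  primitive (fun x => K x * L x) (fun x => k x * L x + K x * l x).
Proof.
move=> dK dL x; apply: is_derive_eq; first exact: is_deriveM (dK x) (dL x).
by rewrite addrC (mulrC (k x)).
Qed.

Lemma primitive_id : primitive id (fun=> 1).
Proof. by move=> x; exact: is_derive_id. Qed.

Lemma primitive_cst (a : R) : primitive (fun=> a) (fun=> 0).
Proof. by move=> x; exact: is_derive_cst. Qed.

Lemma primitive_sum n (K k : 'I_n -> R -> R) :
  (forall i, primitive (K i) (k i)) ->
  primitive (fun x => \sum_i K i x) (fun x => \sum_i k i x).
Proof.
move=> dK x; have -> : (fun x => \sum_i K i x) = \sum_i K i.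
  by apply/funext => y; rewrite fct_sumE.
by apply: is_derive_sum => i; exact: dK.
Qed.

Lemma primitive_eq K k L l : primitive K k -> K =1 L -> k =1 l -> primitive L l.
Proof. by move=> dK /funext <- /funext <-. Qed.

(** Both K(z) - az and bz - K(z) have nonnegative derivative on [x, y]. *)
Lemma primitive_lip K k (x y : R) (a b : R) : primitive K k -> x <= y ->
  (forall z, x <= z <= y -> a <= k z <= b) ->
  a * (y - x) <= K y - K x <= b * (y - x).
Proof.
move=> dK xy ab.
have d c e : primitive (fun z => c * z + e * K z) (fun z => c * 1 + e * k z).
  by apply: primitiveD; apply: primitiveZ => //; exact: primitive_id.
have := primitive_ge0_le (d (- a) 1) xy; have := primitive_ge0_le (d b (- 1)) xy.
move=> h1 h2; apply/andP; split.
  suff : - a * x + 1 * K x <= - a * y + 1 * K y by lra.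
  by apply: h2 => z /ab; lra.
suff : b * x + - 1 * K x <= b * y + - 1 * K y by lra.
by apply: h1 => z /ab; lra.
Qed.

End Primitives.

(** * Lower Riemann-Stieltjes sums for P(X < Y) *)

Section Comparison.
Context {R : realType} d {T : measurableType d} (P : probability T R).
Variables (X Y : {RV P >-> R}) (F f G g K : R -> R).
Hypothesis XY_indep : forall A B : set R, measurable A -> measurable B ->
  P (X @^-1` A `&` Y @^-1` B) = (P (X @^-1` A) * P (Y @^-1` B))%E.
Hypothesis X_le : forall x : R, 0 <= x <= 1 -> P (X @^-1` `]-oo, x]) = (F x)%:E.
Hypothesis Y_le : forall x : R, 0 <= x <= 1 -> P (Y @^-1` `]-oo, x]) = (G x)%:E.
Hypothesis F_prim : primitive F f.
Hypothesis G_prim : primitive G g.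
(** The increment [K 1 - K 0] is the integral of F dG over [0,1]. *)
Hypothesis K_prim : primitive K (fun x => F x * g x).
Hypothesis f02 : forall x : R, 0 <= x <= 1 -> 0 <= f x <= 2.
Hypothesis g0 : forall x : R, 0 <= x <= 1 -> 0 <= g x.
Hypothesis G0 : G 0 = 0.
Hypothesis G1 : G 1 = 1.

(** F is at most F(y) on [x, y], so F(y) G - K has nonnegative derivative there. *)
Lemma primitive_increment_le (x y : R) : 0 <= x -> x <= y -> y <= 1 ->
  K y - K x <= F y * (G y - G x).
Proof.
move=> x0 xy y1.
have dp : primitive (fun z => F y * G z + -1 * K z)
    (fun z => F y * g z + -1 * (F z * g z)).
  exact: (primitiveD (primitiveZ _ G_prim) (primitiveZ _ K_prim)).
have := primitive_ge0_le dp xy; suff : forall z, x <= z <= y -> F z <= F y.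
  move=> Fz; have h z : x <= z <= y -> 0 <= F y * g z + -1 * (F z * g z).
    move=> zxy; have := Fz _ zxy; have : 0 <= g z by apply: g0; lra.
    by nra.
  by move=> /(_ h); lra.
move=> z /andP[xz zy]; apply: (primitive_ge0_le F_prim zy) => t tzy.
by have /f02/andP[] : 0 <= t <= 1 by lra.
Qed.

Lemma measurable_preimage_RV (Z : {RV P >-> R}) (A : set R) :
  measurable A -> measurable (Z @^-1` A).
Proof.
by move=> mA; rewrite -[X in measurable X]setTI; exact: (@measurable_funPT _ _ _ _ Z).
Qed.

Lemma measurable_RV_lt (Z W : {RV P >-> R}) : measurable [set w | Z w < W w].
Proof.
rewrite (_ : [set w | _] = (W \- Z) @^-1` `]0, +oo[).
  rewrite -[X in measurable X]setTI.
  by apply: measurable_funB => //; exact: measurable_itv.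
by apply/seteqP; split => w /=; rewrite in_itv/= andbT subr_gt0.
Qed.

Lemma prob_slab (x y : R) : 0 <= x -> x <= y -> y <= 1 ->
  P (X @^-1` `]-oo, x] `&` Y @^-1` `]x, y]) = (F x * (G y - G x))%:E.
Proof.
move=> x0 xy y1; rewrite XY_indep//.
rewrite X_le; last by rewrite x0 (le_trans xy).
have x01 : 0 <= x <= 1 by rewrite x0 (le_trans xy).
have y01 : 0 <= y <= 1 by rewrite (le_trans x0 xy).
have mY (z : R) : measurable (Y @^-1` `]-oo, z]).
  by apply: (@measurable_preimage_RV Y); exact: measurable_itv.
have -> : Y @^-1` `]x, y] = Y @^-1` `]-oo, y] `\` Y @^-1` `]-oo, x].
  apply/seteqP; split => w /=; rewrite !in_itv/=.
    by case/andP => ax xb; split => //; apply/negP; rewrite -ltNge.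
  by case=> -> /negP; rewrite -ltNge => ->.
have Plt (z : R) : (P (Y @^-1` `]-oo, z]) < +oo)%E.
  by rewrite ltey_eq fin_num_measure.
have YS : Y @^-1` `]-oo, x] `<=` Y @^-1` `]-oo, y].
  by move=> w /=; rewrite !in_itv/= => /le_trans; apply.
have -> : P (Y @^-1` `]-oo, y] `\` Y @^-1` `]-oo, x]) =
    (P (Y @^-1` `]-oo, y]) - P (Y @^-1` `]-oo, x]))%E.
  by rewrite measureD ?(setIidr YS); [|exact: mY|exact: mY|exact: Plt].
by rewrite !Y_le.
Qed.

(* The slabs [X <= x_b < Y <= x_(b+1)] of a fine mesh are disjoint and fill up the
   event [X < Y]; their total mass is a lower Riemann-Stieltjes sum of F dG. *)
Lemma prob_gt_half : 2^-1 < K 1 - K 0 ->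
  (P [set w | (X w < Y w)%R] > (2^-1)%:E)%E.
Proof.
(* N is chosen so that the mesh error 2/N stays below the excess of c over 1/2. *)
set c := _ - _ => c2; pose N := (Num.truncn (2 / (c - 2^-1))).+1.
have N0 : 0 < N%:R :> R by rewrite ltr0n.
have d0 : 0 < c - 2^-1 by rewrite subr_gt0.
have Nc : 2 / N%:R < c - 2^-1.
  by rewrite ltr_pdivrMr// mulrC -ltr_pdivrMr// truncnS_gt.
pose x (b : nat) : R := b%:R / N%:R.
have x0 b : 0 <= x b by rewrite divr_ge0.
have xS b : x b.+1 = x b + N%:R^-1 by rewrite /x -(natr1 b) mulrDl mul1r.
have xx b : x b <= x b.+1 by rewrite xS lerDl invr_ge0 ltW.
have x1 b : (b <= N)%N -> x b <= 1 by move=> bN; rewrite ler_pdivrMr// mul1r ler_nat.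
pose E (b : 'I_N) := X @^-1` `]-oo, x b] `&` Y @^-1` `]x b, x b.+1].
have mE b : measurable (E b).
  by apply: measurableI; apply: measurable_preimage_RV; exact: measurable_itv.
have mlt := measurable_RV_lt X Y.
have PE : P (\big[setU/set0]_(b < N) E b) =
    (\sum_(b < N) (F (x b) * (G (x b.+1) - G (x b))))%:E.
  rewrite measure_bigsetU_ord//; last first.
    apply/trivIsetP => i j _ _; rewrite -subset0 => ij w [[_ wi] [_ wj]].
    move: wi wj; rewrite /= !in_itv/= => /andP[i1 i2] /andP[j1 j2].
    have xl (a b : 'I_N) : x a < Y w -> Y w <= x b.+1 -> (a <= b)%N.
      move=> h1 h2; have := lt_le_trans h1 h2.
      by rewrite /x ltr_pM2r ?invr_gt0// ltr_nat ltnS.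
    move/eqP: ij; apply; apply/val_inj/eqP.
    by rewrite eqn_leq (xl _ _ i1 j2) (xl _ _ j1 i2).
  rewrite -sumEFin; apply: eq_bigr => b _; apply: prob_slab => //; exact: x1.
apply: (@lt_le_trans _ _ (P (\big[setU/set0]_(b < N) E b))); last first.
  apply: le_measure; rewrite ?inE//; first exact: bigsetU_measurable.
  rewrite -bigcup_seq => w [b _ [/=]]; rewrite !in_itv/= => Xb /andP[bY _].
  exact: le_lt_trans Xb bY.
rewrite PE lte_fin.
have tele (h : R -> R) : \sum_(b < N) (h (x b.+1) - h (x b)) = h 1 - h 0.
  rewrite -(big_mkord xpredT (fun b => h (x b.+1) - h (x b))) telescope_sumr//.
  by rewrite /x mul0r divff// gt_eqF.
(* On each mesh interval the increment of K is at most F at the right end times the increment of G.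
   Moving to the left end costs at most 2/N, as f is at most 2, and the increments of G add up to
   1. *)
suff : c <= \sum_(b < N) (F (x b) * (G (x b.+1) - G (x b))) + 2 / N%:R by lra.
have -> : 2 / N%:R = 2 / N%:R * \sum_(b < N) (G (x b.+1) - G (x b)).
  by rewrite tele G1 G0 subr0 mulr1.
rewrite /c -(tele K).
rewrite mulr_sumr -big_split/=; apply: ler_sum => b _; rewrite -mulrDl.
have Gb : 0 <= G (x b.+1) - G (x b).
  have := @primitive_ge0_le R _ _ (x b) (x b.+1) G_prim (xx b); rewrite subr_ge0; apply.
  move=> z /andP[z1 z2]; apply: g0; rewrite (le_trans (x0 b) z1)/=.
  by rewrite (le_trans z2)// x1.
apply: le_trans (primitive_increment_le (x0 b) (xx b) (x1 _ (ltn_ord b))) _.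
apply: ler_wpM2r => //.
have h : 0 * (x b.+1 - x b) <= F (x b.+1) - F (x b) <= 2 * (x b.+1 - x b).
  apply: (primitive_lip F_prim (xx b)) => z /andP[z1 z2]; apply: f02.
  by rewrite (le_trans (x0 b) z1)/= (le_trans z2)// x1.
have e : x b.+1 - x b = N%:R^-1 by rewrite xS addrC addKr.
by rewrite e in h; lra.
Qed.

End Comparison.

(** * Realizing prescribed distribution functions *)

Section Quantile.
Context {R : realType}.

(** Q is the inverse of F on [0,1], given by the intermediate value theorem. The last clause is what
    makes Q of a uniform variable have distribution function F. *)
Lemma quantile_exists (F f : R -> R) : primitive F f ->
  (forall x, 0 <= x <= 1 -> 0 < f x) -> F 0 = 0 -> F 1 = 1 ->
  exists Q : R -> R, [/\ {homo Q : u v / u <= v}, forall u, 0 <= Q u <= 1 &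
    forall u x, 0 <= u <= 1 -> 0 <= x <= 1 -> (Q u <= x) = (u <= F x)].
Proof.
move=> Ff f0 F0 F1.
have Fle x y : 0 <= x -> x <= y -> y <= 1 -> F x <= F y.
  move=> x0 xy y1; apply: (primitive_ge0_le Ff xy) => z /andP[xz zy].
  by rewrite ltW// f0// (le_trans x0 xz) (le_trans zy y1).
have Flt x y : 0 <= x -> x < y -> y <= 1 -> F x < F y.
  move=> x0 xy y1.
  have [|z zxy e] := @MVT R F f x y xy (fun z _ => Ff z).
    exact/continuous_subspaceT/(primitive_continuous Ff).
  rewrite -subr_gt0 e mulr_gt0 ?subr_gt0//; apply: f0.
  by move: zxy; rewrite in_itv/=; lra.
(* Clipping extends the inverse to a nondecreasing function on the whole line, which is therefore
   Borel measurable. *)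
pose clip (u : R) := Num.max 0 (Num.min u 1).
have clip01 u : 0 <= clip u <= 1.
  by rewrite le_max lexx/= ge_max ler01 ge_min lexx orbT.
have clip_le u v : u <= v -> clip u <= clip v.
  by move=> uv; rewrite ge_max !le_max lexx/= le_min !ge_min uv lexx !orbT.
have clip_id u : 0 <= u <= 1 -> clip u = u.
  by move=> /andP[u0 u1]; rewrite /clip (min_idPl u1) (max_idPr u0).
have ex u : exists x, 0 <= x <= 1 /\ F x = clip u.
  have [||x x01 e] := @IVT R F 0 1 (clip u) ler01.
  - exact/continuous_subspaceT/(primitive_continuous Ff).
  - by rewrite F0 F1 (min_idPl ler01) (max_idPr ler01).
  - by exists x; rewrite in_itv/= in x01.
pose Q u := sval (cid (ex u)).
have Q01 u : 0 <= Q u <= 1 by have [] := svalP (cid (ex u)).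
have FQ u : F (Q u) = clip u by have [] := svalP (cid (ex u)).
exists Q; split => // [u v uv|u x u01 /andP[x0 x1]].
  rewrite leNgt; apply/negP => vu; have := Flt _ _ _ vu.
  have /andP[-> _] := Q01 v; have /andP[_ ->] := Q01 u.
  by move=> /(_ isT isT); rewrite !FQ ltNge clip_le.
have /andP[q0 q1] := Q01 u.
apply/idP/idP => h; first by rewrite -(clip_id _ u01) -FQ Fle.
rewrite leNgt; apply/negP => /(Flt _ _ x0)/(_ q1).
by rewrite FQ clip_id// ltNge h.
Qed.

(** For nonnegative X the expectation is the integral of P(X > x) over x from 0 on. The part beyond
    1 vanishes, and on [0,1] the integral of 1 - F is 1 - 1/2. *)
Lemma expectation_half d (T : measurableType d) (P : probability T R)
    (X : {RV P >-> R}) (F Phi : R -> R) :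
  (forall w, 0 <= X w <= 1) ->
  (forall x : R, 0 <= x <= 1 -> P (X @^-1` `]-oo, x]) = (F x)%:E) ->
  primitive Phi F -> continuous F -> Phi 1 - Phi 0 = 2^-1 ->
  ('E_P[X] = (2^-1)%:E)%E.
Proof.
move=> X01 XF dPhi cF Phi2.
rewrite ge0_expectation_ccdf; last by move=> w; have /andP[] := X01 w.
have -> : `[(0 : R), +oo[%classic = `[0, 1] `|` `]1, +oo[.
  by apply/seteqP; split => x /=; rewrite !in_itv/= !andbT; lra.
rewrite ge0_integral_setU//=; first last.
- apply/disj_setPS => x [/=]; rewrite !in_itv/=; lra.
- by apply: measurable_funTS; exact: ccdf_measurable.
rewrite [X in (_ + X)%E]integral0_eq ?adde0; last first.
  move=> x /=; rewrite in_itv/= andbT => x1.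
  rewrite /ccdf /distribution /pushforward (_ : _ @^-1` _ = set0) ?measure0//.
  rewrite -subset0 => w /=; rewrite in_itv/= andbT.
  by have := X01 w; lra.
transitivity (\int[@lebesgue_measure R]_(x in `[0%R, 1%R]) (1 - F x)%:E)%E.
  apply: eq_integral => x; rewrite inE/= in_itv/= => x01.
  by rewrite ccdf_1_cdf /cdf /distribution /pushforward XF// EFinB.
have dK : primitive (fun x => 1 * x + -1 * Phi x) (fun x => 1 * 1 + -1 * F x).
  exact: (primitiveD (primitiveZ _ primitive_id) (primitiveZ _ dPhi)).
have cK := primitive_continuous dK.
rewrite (continuous_FTC2 (F := fun x => 1 * x + -1 * Phi x))//.
- by rewrite -EFinB; congr _%:E; lra.
- apply: continuous_subspaceT => x; apply: cvgB; [exact: cvg_cst|exact: cF].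
- split.
  + by move=> x _; have [] := dK x.
  + by apply: cvg_at_right_filter; exact: cK.
  + by apply: cvg_at_left_filter; exact: cK.
- move=> x _; rewrite derive1E; have [_ ->] := dK x; lra.
Qed.

End Quantile.

(** * Independent variables with prescribed distribution functions *)

Section Realization.
Context {R : realType}.
Local Notation RR := (measurableTypeR R).
Local Notation unif := (uniform_prob (@ltr01 R)).
Variables F f Phi : nat -> R -> R.
Hypothesis F_prim : forall i, primitive (F i) (f i).
Hypothesis f_gt0 : forall i (x : R), 0 <= x <= 1 -> 0 < f i x.
Hypothesis F0 : forall i, F i 0 = 0.
Hypothesis F1 : forall i, F i 1 = 1.
Hypothesis Phi_prim : forall i, primitive (Phi i) (F i).
Hypothesis Phi_half : forall i, Phi i 1 - Phi i 0 = 2^-1.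

Lemma realization : exists (d : measure_display) (T : measurableType d)
    (P : probability T R) (X : nat -> {RV P >-> R}),
  [/\ mutually_independent X, forall i, continuous_rv01 (X i),
      forall i, ('E_P[X i] = (2^-1)%:E)%E &
      forall i (x : R), 0 <= x <= 1 -> P (X i @^-1` `]-oo, x]) = (F i x)%:E].
Proof.
have /choice[Q HQ] i := quantile_exists (F_prim i) (@f_gt0 i) (F0 i) (F1 i).
have mQ i : measurable_fun [set: RR] (Q i : RR -> RR).
  by have [Qh _ _] := HQ i; exact: nondecreasing_measurable.
have mX i : measurable_fun [set: RR] (Q i \o iid i : RR -> RR).
  exact: (measurableT_comp (mQ i) (@measurable_iid R i)).
pose X i : {RV unif >-> R} := mfun_Sub (mem_set (mX i)).
have XE i A : X i @^-1` A = iid i @^-1` (Q i @^-1` A) by [].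
have mQA i A : measurable A -> measurable (Q i @^-1` A : set RR).
  by move=> mA; rewrite -[X in measurable X]setTI; exact: mQ.
have PX i A : measurable A -> unif (X i @^-1` A) = unif (Q i @^-1` A).
  by move=> mA; rewrite XE unif_iid//; exact: mQA.
have X01 i w : 0 <= X i w <= 1 by have [_ + _] := HQ i; exact.
have F01 i x : 0 <= x <= 1 -> 0 <= F i x <= 1.
  move=> /andP[x0 x1]; rewrite -{1}(F0 i) -(F1 i); apply/andP; split.
    apply: (primitive_ge0_le (F_prim i) x0) => z /andP[z0 zx].
    by rewrite ltW// f_gt0// z0 (le_trans zx).
  apply: (primitive_ge0_le (F_prim i) x1) => z /andP[xz z1].
  by rewrite ltW// f_gt0// z1 (le_trans x0 xz).
have XF i (x : R) : 0 <= x <= 1 -> unif (X i @^-1` `]-oo, x]) = (F i x)%:E.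
  move=> x01; rewrite -unif_ray ?F01// -(@unif_iid R i `]-oo, F i x])//.
  congr (unif _); apply/seteqP; have [_ _ QE] := HQ i.
  have XQ w : (X i w <= x) = (iid i w <= F i x).
    by apply: QE => //; exact: iid_ge0_le1.
  by split => w /=; rewrite !in_itv/= XQ.
(* Outside [0,1] the distribution function is constant, so it is [F i] at the clipped argument;
   continuity on the whole line follows. *)
have distE i x : dist_fun (X i) x = F i (Num.max 0 (Num.min x 1)).
  rewrite /dist_fun /cdf /distribution /pushforward.
  have [x0|x0] := ltP x 0.
    rewrite (max_idPl _) ?F0; last by rewrite ge_min ltW.
    rewrite (_ : _ @^-1` _ = set0) ?measure0// -subset0 => w /=.
    by rewrite in_itv/=; have /= := X01 i w; lra.
  have [x1|x1] := leP x 1; first rewrite (max_idPr x0).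
    by transitivity (fine (unif (X i @^-1` `]-oo, x]))) => //; rewrite XF ?x0.
  rewrite (max_idPr ler01) F1 (_ : _ @^-1` _ = setT) ?probability_setT//.
  by rewrite -subTset => w _ /=; rewrite in_itv/=; have /= := X01 i w; lra.
exists _, RR, unif, X; split => //.
(* The finite index list is completed to an initial segment by the sure event, whose factors equal
   1. *)
- move=> J B uJ mB; pose N := (\max_(i <- J) i).+1.
  pose C n : set RR := if n \in J then Q n @^-1` B n else setT.
  have mC n : measurable (C n).
    by rewrite /C; case: ifPn => [nJ|_]; [exact: (mQA _ _ (mB _ nJ))|exact: measurableT].
  have JN i : i \in J -> (i < N)%N.
    by move=> iJ; rewrite ltnS; exact: (@leq_bigmax_seq _ J xpredT id i).
  have -> : \bigcap_(i in [set` J]) (X i @^-1` B i) =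
      \bigcap_(n in `I_N) (iid n @^-1` C n).
    apply/seteqP; split => w h i /=.
      by move=> iN; rewrite /C; case: ifPn => // iJ; exact: h.
    by move=> iJ; have := h i (JN i iJ); rewrite /C iJ.
  apply: etrans (iid_independent N mC) _.
  rewrite (eq_bigr (fun i => if i \in J then unif (X i @^-1` B i) else 1%E)); last first.
    move=> i _; rewrite /C; case: ifPn => iJ; last exact: probability_setT.
    by rewrite PX//; exact: mB.
  rewrite -big_mkcond -big_filter; apply: perm_big; apply: uniq_perm => //.
    by rewrite filter_uniq// iota_uniq.
  by move=> i; rewrite mem_filter mem_index_iota; case: (boolP (i \in J)) => // /JN.
- move=> i; split; [|split; [|split]].
  + rewrite (_ : dist_fun (X i) = F i \o (fun x => Num.max 0 (Num.min x 1))).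
      move=> x; apply: continuous_comp; last exact: (primitive_continuous (F_prim i)).
      apply: (@continuous_max R R (cst 0) (fun x => Num.min x 1)).
        exact: cvg_cst.
      by apply: (@continuous_min R R id (cst 1)); [exact: cvg_id|exact: cvg_cst].
    by apply/funext => x; exact: distE.
  + move=> x y; rewrite !in_itv/= => /andP[x0 x1] /andP[y0 y1] xy.
    rewrite !distE (min_idPl x1) (min_idPl y1) (max_idPr x0) (max_idPr y0).
    have [|z zxy e] := @MVT R (F i) (f i) x y xy (fun z _ => F_prim i z).
      exact/continuous_subspaceT/(primitive_continuous (F_prim i)).
    rewrite -subr_gt0 e mulr_gt0 ?subr_gt0//; apply: f_gt0.
    by move: zxy; rewrite in_itv/=; lra.
  + by rewrite distE (min_idPl ler01) (max_idPl (lexx 0)) F0.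
  + by rewrite distE (min_idPl (lexx 1)) (max_idPr ler01) F1.
- move=> i; apply: (expectation_half (X01 i) (XF i) (Phi_prim i) _ (Phi_half i)).
  exact: primitive_continuous (F_prim i).
Qed.

End Realization.

(** * Trigonometric polynomials *)

Section Integral01.
Context {R : realType}.
Implicit Types f g : R -> R.

(** The integral over [0,1] as a relation carrying its antiderivative, which later serves as [Phi]
    or as the [K] of the comparison. *)
Definition integral01 f (c : R) := exists2 K, primitive K f & K 1 - K 0 = c.

Lemma integral01D f g c e : integral01 f c -> integral01 g e ->
  integral01 (fun x => f x + g x) (c + e).
Proof.
by move=> [K dK <-] [L dL <-]; exists (fun x => K x + L x); [exact: primitiveD|ring].
Qed.

Lemma integral01Z (a : R) f c : integral01 f c -> integral01 (fun x => a * f x) (a * c).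
Proof.
by move=> [K dK <-]; exists (fun x => a * K x); [exact: primitiveZ|ring].
Qed.

Lemma integral01_sum n (f : 'I_n -> R -> R) (c : 'I_n -> R) :
  (forall i, integral01 (f i) (c i)) ->
  integral01 (fun x => \sum_i f i x) (\sum_i c i).
Proof.
move=> fc; have [K dK Kc] : exists2 K : 'I_n -> R -> R,
    forall i, primitive (K i) (f i) & forall i, K i 1 - K i 0 = c i.
  have /choice[K HK] i : exists K : R -> R, primitive K (f i) /\ K 1 - K 0 = c i.
    by have [K] := fc i; exists K.
  by exists K => i; have [] := HK i.
exists (fun x => \sum_i K i x); first exact: primitive_sum.
by rewrite -sumrB; apply: eq_bigr => i _; exact: Kc.
Qed.

Lemma integral01_eq f g c e : integral01 f c -> f =1 g -> c = e -> integral01 g e.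
Proof. by move=> fc /funext <- <-. Qed.

Lemma integral01_id : integral01 id (2^-1).
Proof.
exists (fun x : R => 2^-1 * (x * x)); last by rewrite !mulr1 !mulr0 subr0.
apply: primitive_eq (primitiveZ 2^-1 (primitiveM primitive_id primitive_id)) _ _ => //.
by move=> x /=; field.
Qed.

Definition freq (m : nat) : R := pi *+ 2 *+ m.

Lemma freqD m n : freq (m + n) = freq m + freq n.
Proof. by rewrite /freq mulrnDr. Qed.

Lemma freq_gt0 m : 0 < freq m.+1.
Proof. by rewrite /freq pmulrn_lgt0// pmulrn_lgt0// pi_gt0. Qed.

Lemma cos_freq m : cos (freq m) = 1.
Proof.
elim: m => [|m IH]; first by rewrite /freq mulr0n cos0.
by rewrite -addn1 freqD /freq mulr1n cosD2pi.
Qed.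

Lemma sin_freq m : sin (freq m) = 0.
Proof.
elim: m => [|m IH]; first by rewrite /freq mulr0n sin0.
by rewrite -addn1 freqD /freq mulr1n sinD2pi.
Qed.

Lemma primitive_linear (a : R) : primitive (fun x => a * x) (fun=> a).
Proof.
by apply: primitive_eq (primitiveZ a primitive_id) _ _ => // x; rewrite mulr1.
Qed.

Lemma primitive_sin (a : R) :
  primitive (fun x => sin (a * x)) (fun x => a * cos (a * x)).
Proof.
move=> x; rewrite mulrC; apply: (@is_derive1_comp R sin (fun x => a * x)).
exact: primitive_linear.
Qed.

Lemma primitive_cos (a : R) :
  primitive (fun x => cos (a * x)) (fun x => - a * sin (a * x)).
Proof.
move=> x; rewrite mulNr -mulrN mulrC; apply: (@is_derive1_comp R cos (fun x => a * x)).
exact: primitive_linear.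
Qed.

Lemma integral01_cos m : integral01 (fun x => cos (freq m * x)) (m == 0%N)%:R.
Proof.
case: m => [|m].
  exists id; last by rewrite subr0.
  apply: primitive_eq primitive_id _ _ => // x.
  by rewrite /freq mulr0n mul0r cos0.
exists (fun x => (freq m.+1)^-1 * sin (freq m.+1 * x)); last first.
  by rewrite mulr1 mulr0 sin_freq sin0 subrr.
apply: primitive_eq (primitiveZ _ (primitive_sin (freq m.+1))) _ _ => // x.
by rewrite mulrA mulVf ?mul1r// gt_eqF// freq_gt0.
Qed.

Lemma integral01_sin m : integral01 (fun x => sin (freq m * x)) 0.
Proof.
case: m => [|m].
  exists (fun=> 0); last by rewrite subrr.
  apply: primitive_eq (primitive_cst 0) _ _ => // x.
  by rewrite /freq mulr0n mul0r sin0.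
exists (fun x => - (freq m.+1)^-1 * cos (freq m.+1 * x)); last first.
  by rewrite mulr1 mulr0 cos_freq cos0 subrr.
apply: primitive_eq (primitiveZ _ (primitive_cos (freq m.+1))) _ _ => // x.
by rewrite mulrA mulrNN mulVf ?mul1r// gt_eqF// freq_gt0.
Qed.

(** Frequencies have natural indices, so the difference is treated by order, using that cosine is
    even. *)
Lemma integral01_cosB k l :
  integral01 (fun x => cos ((freq k - freq l) * x)) (k == l)%:R.
Proof.
have [kl|/ltnW kl] := leqP l k; move: (integral01_cos (k - l)) (integral01_cos (l - k)).
  move=> h _; apply: integral01_eq h _ _ => [x|]; last by congr (_ : bool)%:R; lia.
  by rewrite -[in freq k](subnK kl) freqD addrK.
move=> _ h; apply: integral01_eq h _ _ => [x|]; last by congr (_ : bool)%:R; lia.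
by rewrite -[in freq l](subnK kl) freqD opprD addrCA subrr addr0 mulNr cosN.
Qed.

Lemma integral01_sinB k l : integral01 (fun x => sin ((freq k - freq l) * x)) 0.
Proof.
have [kl|/ltnW kl] := leqP l k.
  apply: integral01_eq (integral01_sin (k - l)) _ _ => // x.
  by rewrite -[in freq k](subnK kl) freqD addrK.
apply: integral01_eq (integral01Z (-1) (integral01_sin (l - k))) _ _; last by rewrite mulr0.
move=> x; rewrite -[in freq l](subnK kl) freqD opprD addrCA subrr addr0.
by rewrite [in RHS]mulNr sinN mulN1r.
Qed.

(** Product-to-sum formula. The shifted indices make the sum frequency nonzero, so that its term
    integrates to 0. *)
Lemma integral01_cos_cos k l :
  integral01 (fun x => cos (freq k.+1 * x) * cos (freq l.+1 * x)) ((k == l)%:R / 2).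
Proof.
have := integral01D (integral01Z 2^-1 (integral01_cosB k.+1 l.+1))
  (integral01Z 2^-1 (integral01_cos (k.+1 + l.+1))).
move/integral01_eq; apply => [x|].
  by rewrite freqD mulrBl mulrDl cosB cosD; field.
by rewrite mulr0 addr0 eqSS mulrC.
Qed.

Lemma integral01_sin_sin k l :
  integral01 (fun x => sin (freq k.+1 * x) * sin (freq l.+1 * x)) ((k == l)%:R / 2).
Proof.
have := integral01D (integral01Z 2^-1 (integral01_cosB k.+1 l.+1))
  (integral01Z (- 2^-1) (integral01_cos (k.+1 + l.+1))).
move/integral01_eq; apply => [x|].
  by rewrite freqD mulrBl mulrDl cosB cosD; field.
by rewrite mulr0 addr0 eqSS mulrC.
Qed.

Lemma integral01_sin_cos k l :
  integral01 (fun x => sin (freq k.+1 * x) * cos (freq l.+1 * x)) 0.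
Proof.
have := integral01D (integral01Z 2^-1 (integral01_sinB k.+1 l.+1))
  (integral01Z 2^-1 (integral01_sin (k.+1 + l.+1))).
move/integral01_eq; apply => [x|]; last by rewrite mulr0 addr0.
by rewrite freqD mulrBl mulrDl sinB sinD; field.
Qed.

End Integral01.

(** * The alternating form on trigonometric polynomials *)

Section TrigPolynomials.
Context {R : realType}.
Implicit Types (a b : nat -> R) (N : nat).

Let w (k : nat) : R := freq k.+1.

(** Dividing the sine coefficients by the frequency gives the alternating form the same weight at
    every frequency. *)
Definition trig N a b (x : R) : R :=
  \sum_(k < N) (a k / w k * sin (w k * x) + b k * cos (w k * x)).

Definition dtrig N a b (x : R) : R :=
  \sum_(k < N) (a k * cos (w k * x) - b k * w k * sin (w k * x)).

Let w0 k : w k != 0. Proof. by rewrite gt_eqF// freq_gt0. Qed.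

Lemma primitive_trig N a b : primitive (trig N a b) (dtrig N a b).
Proof.
apply: primitive_sum => k.
have := primitiveD (primitiveZ (a k / w k) (primitive_sin (w k)))
  (primitiveZ (b k) (primitive_cos (w k))).
by move/primitive_eq; apply => // x; move: (w k) (w0 k) => v v0; field.
Qed.

Lemma trig0 N a b : trig N a b 0 = \sum_(k < N) b k.
Proof. by apply: eq_bigr => k _; rewrite mulr0 sin0 cos0 mulr0 add0r mulr1. Qed.

Lemma trig1 N a b : trig N a b 1 = \sum_(k < N) b k.
Proof.
apply: eq_bigr => k _.
by rewrite mulr1 /w sin_freq cos_freq mulr0 add0r mulr1.
Qed.

Lemma integral01_trig N a b : integral01 (trig N a b) 0.
Proof.
have := integral01_sum (fun k : 'I_N => integral01D
  (integral01Z (a k / w k) (integral01_sin k.+1))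
  (integral01Z (b k) (integral01_cos k.+1))).
move/integral01_eq; apply => //; apply: big1 => k _.
by rewrite /= !mulr0 addr0.
Qed.

(** Used to bring two polynomials to a common number of terms before pairing them. *)
Lemma trig_widen N M a b x : (N <= M)%N -> (forall k, (N <= k)%N -> a k = 0 /\ b k = 0) ->
  trig N a b x = trig M a b x.
Proof.
move=> NM ab; rewrite /trig (big_ord_widen M
  (fun k => a k / w k * sin (w k * x) + b k * cos (w k * x)) NM) big_mkcond.
apply: eq_bigr => k _; case: ltnP => // /ab[-> ->].
by rewrite !mul0r addr0.
Qed.

Lemma dtrig_widen N M a b x : (N <= M)%N -> (forall k, (N <= k)%N -> a k = 0 /\ b k = 0) ->
  dtrig N a b x = dtrig M a b x.
Proof.
move=> NM ab; rewrite /dtrig (big_ord_widen M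
  (fun k => a k * cos (w k * x) - b k * w k * sin (w k * x)) NM) big_mkcond.
apply: eq_bigr => k _; case: ltnP => // /ab[-> ->].
by rewrite !mul0r subr0.
Qed.

(** By orthogonality only equal frequencies contribute: cosine against cosine gives b a'/2, sine
    against sine gives -a b'/2, and the frequency cancels in the latter. *)
Lemma integral01_trig_dtrig N a b a' b' :
  integral01 (fun x => trig N a b x * dtrig N a' b' x)
    (\sum_(k < N) (b k * a' k - a k * b' k) / 2).
Proof.
have sc (k l : nat) : integral01 (fun x =>
    (a k / w k * sin (w k * x) + b k * cos (w k * x)) *
    (a' l * cos (w l * x) - b' l * w l * sin (w l * x)))
    ((k == l)%:R * ((b k * a' k - a k * b' k) / 2)).
  have := integral01D
    (integral01D (integral01Z (a k / w k * a' l) (integral01_sin_cos k l))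
      (integral01Z (- (a k / w k * (b' l * w l))) (integral01_sin_sin k l)))
    (integral01D (integral01Z (b k * a' l) (integral01_cos_cos k l))
      (integral01Z (- (b k * (b' l * w l))) (integral01_sin_cos l k))).
  move/integral01_eq; apply => [x|]; first rewrite -!/(w _).
    move: (w k)^-1 (w l) (sin (w k * x)) (sin (w l * x)) (cos (w k * x)) (cos (w l * x)).
    by move=> vk vl sk sl ck cl; ring.
  case: eqVneq => [<-|_] /=; last by rewrite mulr0n; ring.
  rewrite mulr1n.
  by move: (w k) (w0 k) => v v0; field.
have := integral01_sum (fun k : 'I_N => integral01_sum (fun l : 'I_N => sc k l)).
move/integral01_eq; apply => [x|].
  by rewrite /trig mulr_suml; apply: eq_bigr => k _; rewrite /dtrig mulr_sumr.
apply: eq_bigr => k _; rewrite (bigD1 k)//= eqxx mul1r big1 ?addr0// => l lk.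
by rewrite eq_sym (_ : (l == k :> nat) = false) ?mul0r//; exact: negbTE.
Qed.

Lemma dtrig_bounded N a b : exists2 M : R, 0 <= M & forall x, `|dtrig N a b x| <= M.
Proof.
exists (\sum_(k < N) (`|a k| + `|b k * w k|)) => [|x].
  by apply: sumr_ge0 => k _; rewrite addr_ge0.
apply: (le_trans (ler_norm_sum _ _ _)); apply: ler_sum => k _.
apply: (le_trans (ler_normB _ _)); rewrite !normrM.
by apply: lerD; rewrite ?ler_piMr ?mulr_ge0// ?cos_max ?sin_max.
Qed.

End TrigPolynomials.

(** * Coefficients encoding the tournament *)

Section TournamentCoefficients.
Context {R : realType}.
Variable U : nat -> nat -> Prop.

Definition sgnU (i m : nat) : R := if `[< U i m >] then 1 else -1.

(** The even index 2m with m < i stores the direction of the edge between i and m. *)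
Definition sin_coef (i k : nat) : R :=
  if ~~ odd k && (k./2 < i)%N then sgnU i k./2 else 0.

(** The cosine at 2i meets the sines of all larger indices. Odd indices carry no sine, so
    subtracting the one at 2i+1 makes the value at 0 vanish without changing any pairing. *)
Definition cos_coef (i k : nat) : R := (k == i.*2)%:R - (k == i.*2.+1)%:R.

Lemma coef_support i k : (i.*2.+2 <= k)%N -> sin_coef i k = 0 /\ cos_coef i k = 0.
Proof.
move=> ik; rewrite /sin_coef /cos_coef ifF; last by apply/negP; lia.
have -> : (k == i.*2) = false by apply/eqP; lia.
have -> : (k == i.*2.+1) = false by apply/eqP; lia.
by rewrite subrr.
Qed.

Lemma sum_delta N (c : nat -> R) m : (m < N)%N ->
  \sum_(k < N) ((k : nat) == m)%:R * c k = c m.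
Proof.
move=> mN; rewrite (bigD1 (Ordinal mN))//= eqxx mul1r big1 ?addr0// => k km.
by rewrite (_ : (k == m :> nat) = false) ?mul0r//; exact: negbTE.
Qed.

Lemma sum_cos_coef N (c : nat -> R) i : (i.*2.+2 <= N)%N ->
  \sum_(k < N) cos_coef i k * c k = c i.*2 - c i.*2.+1.
Proof.
move=> iN; under eq_bigr => k _ do rewrite mulrBl.
by rewrite sumrB !sum_delta// ltnW.
Qed.

Lemma sum_cos_sin_coef N i j : (j.*2.+2 <= N)%N ->
  \sum_(k < N) cos_coef j k * sin_coef i k = if (j < i)%N then sgnU i j else 0.
Proof.
move=> jN; rewrite (sum_cos_coef (sin_coef i) jN) /sin_coef.
by rewrite /= odd_double doubleK /= subr0.
Qed.

Lemma sum_cos_coef0 i : \sum_(k < i.*2.+2) cos_coef i k = 0.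
Proof.
under eq_bigr => k _ do rewrite -[cos_coef i k]mulr1.
by rewrite (sum_cos_coef (fun=> 1))// subrr.
Qed.

End TournamentCoefficients.

(** * Perturbed uniform distributions realizing the tournament *)

Unset Implicit Arguments. Set Strict Implicit. Set Printing Implicit Defensive.

Theorem theorem5p13 (R : realType) (U : nat -> nat -> Prop) :
  universal_tournament U ->
  exists (d : measure_display) (T : measurableType d) (P : probability T R)
         (X : nat -> {RV P >-> R}),
    mutually_independent X /\
    (forall i, continuous_rv01 (X i)) /\
    (forall i, ('E_P[X i] = (2^-1)%:E)%E) /\
    (forall i j, (P [set w | (X j w < X i w)%R] > (2^-1)%:E)%E <-> U i j).
Proof.
move=> [[Uirr Utour] _].
pose H i : R -> R := trig i.*2.+2 (sin_coef U i) (cos_coef i).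
pose h i : R -> R := dtrig i.*2.+2 (sin_coef U i) (cos_coef i).
have Hh i : primitive (H i) (h i) by exact: primitive_trig.
have H0 i : H i 0 = 0 by rewrite /H trig0 sum_cos_coef0.
have H1 i : H i 1 = 0 by rewrite /H trig1 sum_cos_coef0.
have IH i : integral01 (H i) 0 by exact: integral01_trig.
(* With M bounding h_i and e = 1/(2(M+1)), the density 1 + e h_i stays between 1/2 and 3/2: it is
   positive and below the bound 2 of the comparison. The added 1 keeps the denominator positive. *)
have /choice[e He] i : exists e : R, 0 < e /\ forall x, `|e * h i x| <= 2^-1.
  have [M M0 hM] := dtrig_bounded i.*2.+2 (sin_coef U i) (cos_coef i : nat -> R).
  have M1 : 0 < 2 * (M + 1) by lra.
  exists (2 * (M + 1))^-1; split=> [|x]; first by rewrite invr_gt0.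
  rewrite normrM ger0_norm ?invr_ge0 ?(ltW M1)// mulrC ler_pdivrMr//.
  by have := hM x; rewrite -/(h i x); lra.
have e0 i : 0 < e i by have [] := He i.
have eh i x : - 2^-1 <= e i * h i x <= 2^-1 by rewrite -ler_norml; have [] := He i.
pose F i (x : R) := x + e i * H i x; pose f i (x : R) := 1 + e i * h i x.
have Ff i : primitive (F i) (f i).
  exact: (primitiveD primitive_id (primitiveZ (e i) (Hh i))).
have f0 i (x : R) : 0 <= x <= 1 -> 0 < f i x by have := eh i x; rewrite /f; lra.
have F0 i : F i 0 = 0 by rewrite /F H0; ring.
have F1 i : F i 1 = 1 by rewrite /F H1; ring.
(* H_i has integral 0, so F_i has the same integral 1/2 as the identity. *)
have /choice[Phi HPhi] i : exists K : R -> R, primitive K (F i) /\ K 1 - K 0 = 2^-1.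
  have [K dK K1] := integral01D integral01_id (integral01Z (e i) (IH i)).
  by exists K; split => //; rewrite K1; ring.
have [d [T [P [X [Xind Xcont XE XF]]]]] := realization Ff f0 F0 F1
  (fun i => (HPhi i).1) (fun i => (HPhi i).2).
exists d, T, P, X; do 3 (split=> //).
have pairwise i j (A B : set R) : i <> j -> measurable A -> measurable B ->
    P (X i @^-1` A `&` X j @^-1` B) = (P (X i @^-1` A) * P (X j @^-1` B))%E.
  move=> ij mA mB; pose C k := if k == i then A else B.
  have ji : (j == i) = false by apply/eqP => e'; apply: ij.
  have /= := Xind [:: i; j] C; rewrite !big_cons big_nil mule1 /C eqxx ji => <-.
  - congr (P _); apply/seteqP; split => w /=.
      by move=> [wA wB] k; rewrite /= !inE => /orP[] /eqP ->; rewrite ?eqxx ?ji.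
    move=> hw; split.
      by have := hw i; rewrite /= eqxx; apply; rewrite !inE eqxx.
    by have := hw j; rewrite /= ji; apply; rewrite !inE eqxx orbT.
  - by rewrite inE eq_sym ji.
  - by move=> k _; case: ifP.
(* Only the sines of the larger index contribute. For j < i they give [sgnU i j] = 1; for i < j they
   give minus [sgnU j i], again 1 because [U j i] is excluded. *)
have omega i j : U i j -> integral01 (fun x => H j x * h i x) (2^-1).
  move=> Uij; pose N := maxn i.*2.+2 j.*2.+2.
  have iN : (i.*2.+2 <= N)%N by rewrite leq_maxl.
  have jN : (j.*2.+2 <= N)%N by rewrite leq_maxr.
  have := integral01_trig_dtrig N (sin_coef U j) (cos_coef j) (sin_coef U i) (cos_coef i : nat -> R).
  move/integral01_eq; apply => [x|].
    rewrite /H /h (trig_widen _ jN) ?(dtrig_widen _ iN)//; exact: coef_support.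
  rewrite -mulr_suml sumrB (sum_cos_sin_coef _ _ jN).
  under [X in _ - X]eq_bigr => k _ do rewrite mulrC.
  rewrite (sum_cos_sin_coef _ _ iN) /sgnU.
  have [ij|ij|ij] := ltngtP i j.
  - rewrite asboolF; last by move=> Uji; have [] := Utour i j; [lia|move=> _; apply].
    by ring.
  - by rewrite asboolT// subr0 mul1r.
  - by subst j; case: (Uirr i).
have gt_half i j : U i j -> (P [set w | (X j w < X i w)%R] > (2^-1)%:E)%E.
  move=> Uij; have ji : j <> i by move=> ji; subst j; exact: Uirr Uij.
  (* Integration by parts: x H_i vanishes at both ends and H_i has integral 0. *)
  have Ixh : integral01 (fun x => x * h i x) 0.
    have [K dK K01] := IH i.
    exists (fun x => x * H i x + -1 * K x); last by rewrite H1 H0 mulr0 mul0r; lra.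
    have := primitiveD (primitiveM primitive_id (Hh i)) (primitiveZ (-1) dK).
    by move/primitive_eq; apply => // x /=; ring.
  (* The product F_j f_i expands into x, e_i x h_i, e_j H_j and e_j e_i H_j h_i, with integrals 1/2,
     0, 0 and e_j e_i / 2. *)
  have [K dK K01] := integral01D (integral01D integral01_id (integral01Z (e i) Ixh))
    (integral01D (integral01Z (e j) (IH j)) (integral01Z (e j * e i) (omega i j Uij))).
  apply: (@prob_gt_half R d T P (X j) (X i) (F j) (f j) (F i) (f i) K) => //.
  - by move=> A B; exact: pairwise.
  - by move=> x; exact: XF.
  - by move=> x; exact: XF.
  - by apply: primitive_eq dK _ _ => // x; rewrite /F /f; ring.
  - by move=> x _; have := eh j x; rewrite /f; lra.
  - by move=> x /(f0 i)/ltW.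
  - by rewrite K01 !mulr0 addr0 add0r ltrDl mulr_gt0// mulr_gt0.
move=> i j; split; last exact: gt_half.
have mlt k l : measurable [set w | X k w < X l w] := measurable_RV_lt (X k) (X l).
(* Without the edge from i to j, either i = j and the event is empty, or the reverse edge makes the
   opposite strict inequality likelier than 1/2; two disjoint events cannot both be. *)
move=> Pij; apply: contrapT => nUij.
have [ij|/eqP ij] := eqVneq i j.
  subst j; move: Pij; rewrite (_ : [set w | _] = set0) ?measure0 ?lte_fin.
    by rewrite ltNge invr_ge0 ler0n.
  by rewrite -subset0 => w /=; rewrite ltxx.
have Uji : U j i by have [[]] := Utour i j ij.
have := gt_half _ _ Uji; apply/negP; rewrite -leNgt.
have fP k l : P [set w | X k w < X l w] \is a fin_num by exact: fin_num_measure.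
have : (P [set w | (X i w < X j w)%R] + P [set w | (X j w < X i w)%R] <= 1)%E.
  rewrite -measureU//; first exact/probability_le1/measurableU.
  by rewrite -subset0 => w /= [/lt_trans h1 /h1]; rewrite ltxx.
move: Pij; rewrite -(fineK (fP j i)) -(fineK (fP i j)) -EFinD !lee_fin !lte_fin.
lra.
Qed.
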